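(* Let $\lambda$ be a straight or skew shape with $n$ boxes. Then for every $m\in\mathbb N=\{1,2,3,\dots\}$, $\rho^{\lambda,m}\cong S^\lambda\uparrow_{S_n}^{B_n}$.
   Context: $B_n$ is the group of permutations $\pi$ of $\{\pm1,\dots,\pm n\}$ with $\pi(-i)=-\pi(i)$, with Coxeter generators $s_0=(-1,1)$ and $s_i=(i,i+1)(-i,-i-1)$, $1\le i\le n-1$; $S_n=\langle s_1,\dots,s_{n-1}\rangle$, identified with the symmetric group via $s_i\mapsto(i\,\,i{+}1)$. $S^\lambda$ is the representation of $S_n$ on the space with basis the standard Young tableaux $Q$ of shape $\lambda$ filled with $1,\dots,n$, given by $(i\,\,i{+}1)(Q)=\frac1hQ+\sqrt{1-\frac1{h^2}}\,Q^{s_i}$, with $h$ the content of $i+1$ minus the content of $i$ in $Q$ (content of box in row $r$, column $j$ being $j-r$) and $Q^{s_i}$ obtained by swapping $i,i+1$. For a B-Young tableau, the content of the box in row $r$, column $j$ is $j-r+\frac12$. A B-Young tableau is a filling of a skew diagram by $\pm1,\dots,\pm n$, one per box, with $c_{-k}=-c_k$ ($c_k$ the content of the box containing $k$); standard means increasing along rows and down columns. A B-Young tableau is regarded as determined by its positive-content part. For $\pi\in B_n$, $T^\pi$ is $T$ with each entry $k$ replaced by $\pi(k)$. For $m\in\mathbb N$, $T[\lambda,m]$ is the set of standard B-Young tableaux whose positive-content boxes form the shape $\lambda$ and whose smallest positive content is $m+\frac12$. For such $T$ with content vector $(c_1,\dots,c_n)$ let $f(T)=(2c_1,c_2-c_1,\dots,c_n-c_{n-1})$.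 $\rho^{\lambda,m}$ is the representation of $B_n$ on the vector space with basis $T[\lambda,m]$ given by $\rho_{s_i}(T)=\frac1{f_i(T)}T+\sqrt{1-\frac1{f_i(T)^2}}\,T^{s_i}$, $i=0,\dots,n-1$ (the second term vanishing when $f_i(T)=\pm1$, i.e. when $T^{s_i}$ is not standard). *)

(* Defs.v *)
From HB Require Import structures.
From mathcomp Require Import all_boot all_order all_algebra all_fingroup.
From mathcomp Require Import all_field all_character.
Set Implicit Arguments.
Unset Strict Implicit.
Unset Printing Implicit Defensive.
Import Order.TTheory GRing.Theory Num.Theory.
Local Open Scope ring_scope.

(* The set {+-1,...,+-n} is encoded as 'I_n * bool : (k, b) stands for  *)
(* the signed integer  (if b then -1 else 1) * (k+1).                   *)
(* Group multiplication is mathcomp's: (s * t) x = t (s x).             *)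

Definition sgn_elt (n : nat) := ('I_n * bool)%type.
Definition gT (n : nat) := {perm sgn_elt n}.

Definition negs n (x : sgn_elt n) : sgn_elt n := (x.1, ~~ x.2).

Definition sval n (x : sgn_elt n) : int :=
  if x.2 then - (x.1.+1)%:Z else (x.1.+1)%:Z.

Definition Bn (n : nat) : {set gT n} :=
  [set p : gT n | [forall x, p (negs x) == negs (p x)]].

Definition Sn (n : nat) : {set gT n} :=
  [set p in Bn n | [forall x, (p x).2 == x.2]].

(* Coxeter generators: s_0 = (-1,1), s_i = (i,i+1)(-i,-i-1), 1 <= i <= n-1.
   The generator s_i is indexed by i : 'I_n. Entry i (1-indexed) has
   index i-1, entry i+1 has index i. *)
Definition predo n (i : 'I_n) : 'I_n :=
  Ordinal (leq_ltn_trans (leq_pred i) (ltn_ord i)).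

Definition sgen n (i : 'I_n) : gT n :=
  if i == 0%N :> nat then tperm (i, false) (i, true)
  else (tperm (predo i, false) (i, false) * tperm (predo i, true) (i, true))%g.

(* Skew shapes mu / nu (straight shapes: nu = [::]).  Rows and columns  *)
(* are 0-indexed; this does not change contents differences.           *)

Definition is_skew_shape (mu nu : seq nat) :=
  sorted geq mu /\ sorted geq nu /\ (forall r, nth 0 nu r <= nth 0 mu r)%N.

Section Shape.
Variables (mu nu : seq nat).

Local Notation cellT := ('I_(size mu) * 'I_(head 0%N mu))%type.

Definition in_shape (b : cellT) : bool :=
  (nth 0 nu b.1 <= b.2)%N && (b.2 < nth 0 mu b.1)%N.

Definition content (b : cellT) : int := (b.2)%:Z - (b.1)%:Z.

Definition same_row (b1 b2 : cellT) := b1.1 == b2.1.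
Definition same_col (b1 b2 : cellT) := b1.2 == b2.2.

Variable n : nat.

(* A tableau Q is encoded by Q k = the cell containing the entry k+1. *)
Definition is_syt (Q : {ffun 'I_n -> cellT}) : bool :=
  [&& injectiveb Q,
      [forall k, in_shape (Q k)],
      [forall b, in_shape b ==> (b \in codom Q)],
      [forall k, forall l,
         same_row (Q k) (Q l) ==> ((Q k).2 < (Q l).2)%N ==> (k < l)%N] &
      [forall k, forall l,
         same_col (Q k) (Q l) ==> ((Q k).1 < (Q l).1)%N ==> (k < l)%N]].

Definition SYT : {set {ffun 'I_n -> cellT}} := [set Q | is_syt Q].

Definition syt_swap (i : 'I_n) (Q : {ffun 'I_n -> cellT}) : {ffun 'I_n -> cellT} :=
  [ffun k => Q (tperm (predo i) i k)].

Definition syt_h (i : 'I_n) (Q : {ffun 'I_n -> cellT}) : algC :=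
  (content (Q i) - content (Q (predo i)))%:~R.

(* Matrix of (i i+1) acting on S^lambda, for 1 <= i <= n-1.  Row
   convention: entry (Q, Q') is the coefficient of Q' in (i i+1)(Q). *)
Definition young_mx (i : 'I_n) : 'M[algC]_(#|SYT|) :=
  \matrix_(a, b)
    let Q := enum_val a in let Q' := enum_val b in
    let h := syt_h i Q in
    (Q' == Q)%:R * h^-1 + (Q' == syt_swap i Q)%:R * sqrtC (1 - (h ^+ 2)^-1).

(* ---------------- Standard B-Young tableaux in T[lambda, m] *)
(* Such a tableau is determined by its positive-content part, which is *)
(* a filling of lambda by one of +k / -k for each k = 1..n.  It is     *)
(* encoded by T k = (cell containing +-(k+1), true iff the sign is -). *)
Definition btab := {ffun 'I_n -> cellT * bool}.

Definition bcell (T : btab) (k : 'I_n) : cellT := (T k).1.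
Definition bentry (T : btab) (k : 'I_n) : int := sval (k, (T k).2).

Definition is_btab (T : btab) : bool :=
  [&& injectiveb (bcell T),
      [forall k, in_shape (bcell T k)],
      [forall b, in_shape b ==> (b \in codom (bcell T))],
      [forall k, forall l,
         same_row (bcell T k) (bcell T l) ==>
         ((bcell T k).2 < (bcell T l).2)%N ==> (bentry T k < bentry T l)] &
      [forall k, forall l,
         same_col (bcell T k) (bcell T l) ==>
         ((bcell T k).1 < (bcell T l).1)%N ==> (bentry T k < bentry T l)]].

Variable m : nat.

Definition BT : {set btab} := [set T | is_btab T].

Definition min_content : int :=
  let s := [seq content b | b <- enum [set: cellT] & in_shape b] in
  foldr Num.min (head 0 s) s.

(* content of a cell of the positive part: the translate of lambda whose *)
(* smallest content is m + 1/2 *)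
Definition bcontent_cell (b : cellT) : algC :=
  (content b - min_content + m%:Z)%:~R + 2^-1.

(* c_k (k = index, i.e. entry k+1) with c_{-k} = - c_k *)
Definition bc (T : btab) (k : 'I_n) : algC :=
  if (T k).2 then - bcontent_cell (bcell T k) else bcontent_cell (bcell T k).

Definition bf (i : 'I_n) (T : btab) : algC :=
  if i == 0%N :> nat then 2 * bc T i else bc T i - bc T (predo i).

(* T^pi: each entry x replaced by pi(x) *)
Definition btab_act (p : gT n) (T : btab) : btab :=
  [ffun k => let y := (p^-1)%g (k, false) in ((T y.1).1, (T y.1).2 (+) y.2)].

(* matrix of rho_{s_i}; entry (T, T') is the coefficient of T' in rho_{s_i}(T) *)
Definition btab_mx (i : 'I_n) : 'M[algC]_(#|BT|) :=
  \matrix_(a, b)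
    let T := enum_val a in let T' := enum_val b in
    let f := bf i T in
    (T' == T)%:R * f^-1 + (T' == btab_act (sgen i) T)%:R * sqrtC (1 - (f ^+ 2)^-1).

End Shape.

Section Induced.
Variables (T : finGroupType) (G H : {set T}) (d : nat) (sigma : T -> 'M[algC]_d).

Definition rtrans : {set T} := transversal (rcosets H G) G.

(* Induced (row) representation: basis e_i (x) t, t in X; *)
(* (e_i (x) t) g = e_i sigma(t g t'^-1) (x) t', where t g in H t'. *)
Definition ind_rep (g : T) : 'M[algC]_(\sum_(a < #|rtrans|) d) :=
  \mxblock_(a < #|rtrans|, b < #|rtrans|)
    (let t := enum_val a in let t' := enum_val b in
     if t' == transversal_repr 1%g rtrans ((H :* (t * g))%g) then
       sigma (t * g * t'^-1)%g
     else (0 : 'M[algC]_d)).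
End Induced.

Definition rep_iso (T : finGroupType) (G : {set T}) n1 n2
  (r1 : T -> 'M[algC]_n1) (r2 : T -> 'M[algC]_n2) : Prop :=
  exists B : 'M[algC]_(n1, n2),
    [/\ n1 = n2, row_free B & forall x, x \in G -> r1 x *m B = B *m r2 x].

(* Main.v *)
Require Import Defs.
From HB Require Import structures.
From mathcomp Require Import all_boot all_order all_algebra all_fingroup.
From mathcomp Require Import all_field all_character ring zify.
Import Order.TTheory GRing.Theory Num.Theory.
Local Open Scope ring_scope.

(* The matrices [M i] of the generators on [T[lambda, m]] satisfy the Coxeter
   relations of type B. In seminormal form each relation is a rational identity in
   differences of contents, and these do not vanish because two boxes of equal
   content are separated by two further entries. Hence the products
   [M j ... M 1 M 0 M 1 ... M j], which play the role of the sign changes, commute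
   and are permuted by the [M i] with [i > 0]. The all-positive tableaux span a copy
   of [S^lambda] for [S_n]; writing [t] in [B_n] as a permutation times a sign change
   extends this embedding to a Frobenius-reciprocity map from the induced module,
   which intertwines the generators without appealing to a presentation of [B_n].
   The map is onto, since a negative entry can be made positive by generators whose
   off-diagonal coefficient does not vanish (this is where [m > 0] enters), and
   standardization gives [#|T[lambda, m]| >= 2^n f^lambda], so it is bijective;
   [rho] is the induced action transported along it. *)

Set Implicit Arguments.
Unset Strict Implicit.
Unset Printing Implicit Defensive.

(** * Sign changes in a ring with the Coxeter relations of type B *)

Lemma intertwine_prodr (R : pzRingType) (I : Type) (r : seq I) (x y : I -> R) z :
  (forall i, x i * z = z * y i) ->
  (\prod_(i <- r) x i) * z = z * \prod_(i <- r) y i.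
Proof.
move=> xy; elim: r => [|i r IHr]; first by rewrite !big_nil mul1r mulr1.
by rewrite !big_cons -mulrA IHr !mulrA xy.
Qed.

Lemma perm_prodr_comm (R : pzRingType) (I : eqType) (r s : seq I) (x : I -> R) :
  (forall i j, GRing.comm (x i) (x j)) -> perm_eq r s ->
  \prod_(i <- r) x i = \prod_(i <- s) x i.
Proof.
move=> xC; elim: r s => [|i r IHr] s; first by rewrite perm_sym => /perm_nilP->.
move=> rs; have /path.splitPr def_s : i \in s by rewrite -(perm_mem rs) mem_head.
case: def_s rs => s1 s2; rewrite perm_sym perm_catC /= perm_cons perm_catC perm_sym => rs.
have iC : GRing.comm (x i) (\prod_(j <- s1) x j) by apply: commr_prod => j _.
by rewrite big_cons (IHr _ rs) !big_cat /= big_cons !mulrA iC.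
Qed.

Lemma commr_conj (R : pzRingType) (x y z : R) :
  GRing.comm x y -> GRing.comm x z -> GRing.comm x (y * z * y).
Proof. by move=> xy xz; apply: commrM => //; apply: commrM. Qed.

Lemma commr_braid_conj (R : pzRingType) (x y z : R) :
  x * y * x = y * x * y -> GRing.comm y z -> GRing.comm x (y * (x * z * x) * y).
Proof.
move=> braid yz; rewrite /GRing.comm.
transitivity (x * y * x * z * (x * y)); first by rewrite !mulrA.
rewrite braid -(mulrA (y * x)) yz !mulrA -(mulrA _ y x) -(mulrA _ (y * x)).
by rewrite -braid !mulrA.
Qed.

Lemma predo_lt n (i : 'I_n) : (0 < i)%N -> (predo i < i)%N.
Proof. by rewrite /= ltn_predL. Qed.

Lemma predo_neq n (i : 'I_n) : (0 < i)%N -> predo i != i.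
Proof. by move=> i0; rewrite -(inj_eq val_inj) ltn_eqF ?predo_lt. Qed.

Lemma ord_predo_ind n (P : 'I_n -> Prop) :
  (forall i : 'I_n, i = 0%N :> nat -> P i) ->
  (forall i : 'I_n, (0 < i)%N -> P (predo i) -> P i) ->
  forall i, P i.
Proof.
move=> P0 PS i; have [k le_ik] := ubnP (val i); elim: k => // k IHk in i le_ik *.
have [/P0 // | i0] := posnP i.
by apply: PS => //; apply: IHk; apply: leq_trans (predo_lt i0) _.
Qed.

Definition toggle (T : finType) (x : T) (A : {set T}) : {set T} :=
  if x \in A then A :\ x else x |: A.

Lemma in_toggle (T : finType) (x y : T) (A : {set T}) :
  (y \in toggle x A) = (y \in A) (+) (y == x).
Proof.
by rewrite /toggle; case: ifP => xA; rewrite !inE; case: eqP => [->|_];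
  rewrite ?xA ?addbT ?addbF.
Qed.

Definition coxeterB_relations n (R : pzRingType) (M : 'I_n -> R) : Prop :=
  [/\ forall i, M i * M i = 1,
      forall i j : 'I_n, (i.+1 < j)%N -> GRing.comm (M i) (M j),
      forall i : 'I_n, (1 < i)%N ->
        M (predo i) * M i * M (predo i) = M i * M (predo i) * M i
    & forall i : 'I_n, i = 1%N :> nat ->
        M (predo i) * M i * M (predo i) * M i = M i * M (predo i) * M i * M (predo i)].

Section SignReflections.
Variables (n : nat) (R : pzRingType) (M : 'I_n -> R).

Fixpoint sign_refl_rec (k : nat) (j : 'I_n) : R :=
  if k is k'.+1 then M j * sign_refl_rec k' (predo j) * M j else M j.

(* The image of the reflection that changes the sign of [j + 1]. *)
Definition sign_refl (j : 'I_n) : R := sign_refl_rec j j.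

Definition sign_change (A : {set 'I_n}) : R := \prod_(j <- enum A) sign_refl j.

Lemma sign_refl0 (j : 'I_n) : j = 0%N :> nat -> sign_refl j = M j.
Proof. by rewrite /sign_refl => ->. Qed.

Lemma sign_reflS (j : 'I_n) :
  (0 < j)%N -> sign_refl j = M j * sign_refl (predo j) * M j.
Proof. by rewrite /sign_refl /=; case: (val j). Qed.

Hypothesis coxM : coxeterB_relations M.
Let MK i : M i * M i = 1. Proof. by case: coxM. Qed.
Let M_comm (i j : 'I_n) : (i.+1 < j)%N -> GRing.comm (M i) (M j).
Proof. by case: coxM => _ + _ _; apply. Qed.

Lemma comm_sign_refl_gt (i j : 'I_n) :
  (j.+1 < i)%N -> GRing.comm (M i) (sign_refl j).
Proof.
elim/ord_predo_ind: j => j j0; first by move/M_comm/commr_sym; rewrite sign_refl0.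
move=> IHj ji; rewrite sign_reflS //; apply: commr_conj.
  exact/commr_sym/M_comm.
by apply: IHj; apply: leq_ltn_trans ji; rewrite ltnS ltnW ?predo_lt.
Qed.

Lemma comm_sign_refl_lt (i j : 'I_n) :
  (0 < i < j)%N -> GRing.comm (M i) (sign_refl j).
Proof.
elim/ord_predo_ind: j => [j -> |j j0 IHj /andP[i0 ij]]; first by rewrite andbF.
rewrite sign_reflS //; have [/= ij1|/= ji] := ltnP i (predo j).
  by apply: commr_conj; [apply: M_comm; lia | apply: IHj; rewrite i0].
have -> : i = predo j by apply: val_inj => /=; lia.
rewrite sign_reflS /=; last by lia.
apply: commr_braid_conj; last by apply: comm_sign_refl_gt => /=; lia.
by case: coxM => _ _ braid _; apply: braid; lia.
Qed.

Lemma sign_refl_mul (i j : 'I_n) :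
  (0 < i)%N -> sign_refl j * M i = M i * sign_refl (tperm (predo i) i j).
Proof.
move=> i0; case: tpermP => [->|->|ne_jpi ne_ji].
- by rewrite (sign_reflS i0) !mulrA MK mul1r.
- by rewrite (sign_reflS i0) -!mulrA MK mulr1.
apply/esym; have [ij|] := ltnP i j; first by apply: comm_sign_refl_lt; rewrite i0.
rewrite leq_eqVlt => /predU1P[/val_inj //|ji]; apply: comm_sign_refl_gt.
suff : nat_of_ord j <> i.-1 by lia.
by move=> e; apply: ne_jpi; apply: val_inj.
Qed.

Lemma comm_sign_refl0 (i k : 'I_n) :
  i = 0%N :> nat -> GRing.comm (M i) (sign_refl k).
Proof.
move=> i0; elim/ord_predo_ind: k => [k k0|k k0 IHk].
  by rewrite sign_refl0 //; have -> : i = k by apply: val_inj; rewrite /= i0 k0.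
rewrite sign_reflS //; have [k1|k1] := leqP k 1; last first.
  by apply: commr_conj => //; apply: M_comm; rewrite i0.
have -> : i = predo k by apply: val_inj => /=; lia.
rewrite sign_refl0 /=; last by lia.
case: coxM => _ _ _ braid; rewrite /GRing.comm !mulrA; apply: braid; lia.
Qed.

Lemma sign_refl_comm (j k : 'I_n) : GRing.comm (sign_refl j) (sign_refl k).
Proof.
wlog jk : j k / (j < k)%N => [IH|].
  have [|/IH/commr_sym //|/val_inj->] := ltngtP j k; [exact: IH | by []].
elim/ord_predo_ind: j jk => j j0.
  by rewrite sign_refl0 // => _; apply: comm_sign_refl0.
move=> IHj jk; rewrite (sign_reflS j0); apply/commr_sym/commr_conj; apply/commr_sym.
  by apply: comm_sign_refl_lt; rewrite j0.
by apply: IHj; apply: ltn_trans (predo_lt j0) jk.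
Qed.

Lemma sign_change_mul (i : 'I_n) (A : {set 'I_n}) : (0 < i)%N ->
  sign_change A * M i = M i * sign_change (tperm (predo i) i @^-1: A).
Proof.
move=> i0; rewrite /sign_change (intertwine_prodr _ (fun j => sign_refl_mul j i0)).
congr (_ * _).
rewrite -(big_map (tperm (predo i) i) xpredT sign_refl) /=.
apply: perm_prodr_comm sign_refl_comm _.
apply: uniq_perm; rewrite ?enum_uniq ?(map_inj_uniq perm_inj) ?enum_uniq // => j.
by rewrite -{1}[j](tpermK (predo i) i) (mem_map perm_inj) !mem_enum inE.
Qed.

Lemma sign_changeU1 (j : 'I_n) (A : {set 'I_n}) :
  j \notin A -> sign_change (j |: A) = sign_change A * sign_refl j.
Proof.
move=> jA; have enumU : perm_eq (enum (j |: A)) (j :: enum A).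
  apply: uniq_perm; rewrite /= ?mem_enum ?jA ?enum_uniq // => k.
  by rewrite inE !mem_enum !inE.
rewrite /sign_change (perm_prodr_comm sign_refl_comm enumU) big_cons.
by apply: commr_prod => k _; apply: sign_refl_comm.
Qed.

Lemma sign_change_mul0 (i : 'I_n) (A : {set 'I_n}) :
  i = 0%N :> nat -> sign_change A * M i = sign_change (toggle i A).
Proof.
move=> i0; rewrite /toggle -(sign_refl0 i0); case: ifPn => iA.
  rewrite -{1}(setD1K iA) sign_changeU1 ?setD11 // -mulrA sign_refl0 //.
  by rewrite MK mulr1.
by rewrite sign_changeU1.
Qed.

End SignReflections.

(** * Seminormal form *)

Section SeminormalForm.
Variables (C : numClosedFieldType) (N : nat).
Implicit Types (f g : C) (A B : 'M[C]_N) (v w : 'rV[C]_N).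

Definition offdiag f : C := sqrtC (1 - (f ^+ 2)^-1).

Lemma offdiagN f : offdiag (- f) = offdiag f.
Proof. by rewrite /offdiag sqrrN. Qed.

Local Notation offdiag_defect f := (offdiag f ^+ 2 - (1 - (f ^+ 2)^-1)).

Lemma offdiag_defect0 f : offdiag_defect f = 0.
Proof. by rewrite sqrtCK subrr. Qed.

Lemma offdiag_eq0 f : (offdiag f == 0) = (f ^+ 2 == 1).
Proof. by rewrite sqrtC_eq0 subr_eq0 eq_sym invr_eq1. Qed.

Definition seminormal A f v w : Prop := v *m A = f^-1 *: v + offdiag f *: w.

(* In this lemma and in the two braid relations below, the coordinates of the two
   sides differ by a combination of the vanishing [offdiag_defect]s. *)
Lemma seminormal_involution A f v w :
  f != 0 -> seminormal A f v w -> seminormal A (- f) w v -> v *m A *m A = v.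
Proof.
move=> f0 v_A w_A; rewrite v_A mulmxDl -!scalemxAl v_A w_A offdiagN.
apply/rowP => k; rewrite !mxE; apply: subr0_eq.
transitivity (offdiag_defect f * v 0 k); first by field.
by rewrite offdiag_defect0 mul0r.
Qed.

Lemma seminormal_comm A B f g v vA vB w :
  seminormal A f v vA -> seminormal B g v vB ->
  seminormal B g vA w -> seminormal A f vB w -> v *m A *m B = v *m B *m A.
Proof.
move=> v_A v_B vA_B vB_A; rewrite v_A v_B !mulmxDl -!scalemxAl v_A v_B vA_B vB_A.
by apply/rowP => k; rewrite !mxE; ring.
Qed.

Lemma seminormal_braid3 A B a b v vA vB vAB vBA w :
  [/\ a != 0, b != 0 & a + b != 0] ->
  seminormal A a v vA -> seminormal A (- a) vA v ->
  seminormal B b v vB -> seminormal B (- b) vB v ->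
  seminormal B (a + b) vA vAB -> seminormal A (a + b) vB vBA ->
  seminormal A b vAB w -> seminormal B a vBA w ->
  v *m A *m B *m A = v *m B *m A *m B.
Proof.
case=> a0 b0 ab0 v_A vA_A v_B vB_B vA_B vB_A vAB_A vBA_B.
rewrite !(v_A, vA_A, v_B, vB_B, vA_B, vB_A, vAB_A, vBA_B, mulmxDl, =^~ scalemxAl).
rewrite !offdiagN; apply/rowP => k; rewrite !mxE; apply: subr0_eq.
transitivity ((offdiag_defect a - offdiag_defect b) / (a + b) * v 0 k).
  by field; rewrite a0 b0 ab0.
by rewrite !offdiag_defect0 subrr !mul0r.
Qed.

Lemma seminormal_braid4 A B a b v vA vB vAB vBA vABA vBAB w :
  [/\ a != 0, b != 0, a + b != 0 & a + 2 * b != 0] ->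
  seminormal A a v vA -> seminormal A (- a) vA v ->
  seminormal B b v vB -> seminormal B (- b) vB v ->
  seminormal B (a + b) vA vAB -> seminormal B (- (a + b)) vAB vA ->
  seminormal A (a + 2 * b) vB vBA -> seminormal A (- (a + 2 * b)) vBA vB ->
  seminormal A (a + 2 * b) vAB vABA -> seminormal B (a + b) vBA vBAB ->
  seminormal B b vABA w -> seminormal A a vBAB w ->
  v *m A *m B *m A *m B = v *m B *m A *m B *m A.
Proof.
case=> a0 b0 ab0 a2b0 v_A vA_A v_B vB_B vA_B vAB_B vB_A vBA_A vAB_A vBA_B vABA_B vBAB_A.
rewrite !(v_A, vA_A, v_B, vB_B, vA_B, vAB_B, vB_A, vBA_A, vAB_A, vBA_B, vABA_B, vBAB_A,
  mulmxDl, =^~ scalemxAl) !offdiagN.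
apply/rowP => k; rewrite !mxE; apply: subr0_eq.
transitivity (
  (offdiag_defect (a + b) - offdiag_defect b) / (a + 2 * b) * offdiag a * vA 0 k
  + (offdiag_defect a - offdiag_defect (a + 2 * b)) / (a + b) * offdiag b * vB 0 k).
  by field; rewrite a0 b0 ab0 a2b0.
by rewrite !offdiag_defect0 subrr !mul0r addr0.
Qed.

Lemma seminormal_submx p (W : 'M[C]_(p, N)) A f v w :
  seminormal A f v w -> offdiag f != 0 -> stablemx W A -> (v <= W)%MS -> (w <= W)%MS.
Proof.
move=> vA f0 stW vW.
have -> : w = (offdiag f)^-1 *: (v *m A - f^-1 *: v).
  by rewrite vA addrC addKr scalerA mulVf // scale1r.
rewrite scalemx_sub // addmx_sub //; first by apply: submx_trans stW; apply: submxMr.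
by rewrite eqmx_opp scalemx_sub.
Qed.

End SeminormalForm.

(** * Induced representations *)

Section TransportedRepresentation.
Variables (T : finGroupType) (G : {set T}) (n1 n2 : nat).
Variables (r : T -> 'M[algC]_n1) (B : 'M[algC]_(n1, n2)).
Hypotheses (rP : mx_repr G r) (B_free : row_free B) (B_full : row_full B).

Definition transport (x : T) : 'M[algC]_n2 := pinvmx B *m r x *m B.

Lemma transport_repr : mx_repr G transport.
Proof.
case: rP => r1 rM; rewrite /transport.
move: (pinvmx B) (mulVpmx B_full) (mulmxVp B_free) => D DB BD.
split=> [|x y xG yG /=]; first by rewrite r1 mulmx1.
by rewrite rM // !mulmxA -(mulmxA _ B D) BD mulmx1.
Qed.

Lemma transport_intertwined x A : r x *m B = B *m A -> transport x = A.
Proof. by rewrite /transport -mulmxA => ->; rewrite mulmxA mulVpmx // mul1mx. Qed.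

Lemma transport_iso : rep_iso G transport r.
Proof.
exists (pinvmx B); split; first by rewrite -(eqP B_full) (eqP B_free).
  exact: pinvmx_free.
by move=> x _; rewrite /transport mulmxKp.
Qed.

End TransportedRepresentation.

Section InducedRepresentation.
Variables (T : finGroupType) (G H : {group T}) (d : nat) (sigma : T -> 'M[algC]_d).
Hypotheses (sHG : H \subset G) (sigmaP : mx_repr H sigma).
Local Notation X := (rtrans G H).
Local Notation ind := (ind_rep G H sigma).

Definition coset_rep (x : T) : T := transversal_repr 1%g X (H :* x)%g.

Lemma rtransP : is_transversal X (rcosets H G) G.
Proof. by apply: transversalP; apply: rcosets_partition. Qed.

Lemma rtrans_sub : {subset X <= G}.
Proof. by apply/subsetP; apply: transversal_sub rtransP. Qed.

Lemma rcoset_mem_rcosets x : x \in G -> (H :* x)%g \in rcosets H G.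
Proof. by move=> xG; apply/rcosetsP; exists x. Qed.

Lemma pblock_rcosets x : x \in G -> pblock (rcosets H G) x = (H :* x)%g.
Proof.
move=> xG; apply: def_pblock (rcoset_mem_rcosets xG) (rcoset_refl H x).
by case/and3P: (rcosets_partition sHG).
Qed.

Lemma coset_rep_mem x : x \in G -> coset_rep x \in X.
Proof. by move=> xG; apply/(repr_mem_transversal rtransP)/rcoset_mem_rcosets. Qed.

Lemma mul_coset_repV x : x \in G -> (x * (coset_rep x)^-1)%g \in H.
Proof.
move=> xG; have : coset_rep x \in (H :* x)%g.
  exact/(repr_mem_pblock rtransP)/rcoset_mem_rcosets.
by rewrite mem_rcoset => xH; rewrite -groupV invMg invgK.
Qed.

Lemma coset_repM h x : h \in H -> coset_rep (h * x)%g = coset_rep x.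
Proof. by move=> hH; rewrite /coset_rep rcosetM (rcoset_id hH). Qed.

Lemma coset_rep_id x : x \in X -> coset_rep x = x.
Proof.
move=> xX; have xG := rtrans_sub xX; have rG := rtrans_sub (coset_rep_mem xG).
apply: (pblock_inj rtransP (coset_rep_mem xG) xX).
rewrite !pblock_rcosets //; apply/rcoset_eqP.
exact/(repr_mem_pblock rtransP)/rcoset_mem_rcosets.
Qed.

Definition equivariant N (F : T -> 'M[algC]_(d, N)) : Prop :=
  forall h x, h \in H -> x \in G -> F (h * x)%g = sigma h *m F x.

(* The linear map out of the induced module sending [e_i (x) t] to row [i] of
   [F t]. *)
Definition blockrow N (F : T -> 'M[algC]_(d, N)) : 'M[algC]_(\sum_(a < #|X|) d, N) :=
  \mxcol_(a < #|X|) F (enum_val a).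

Lemma eq_blockrow N (F1 F2 : T -> 'M[algC]_(d, N)) :
  {in G, F1 =1 F2} -> blockrow F1 = blockrow F2.
Proof. by move=> F12; apply: eq_mxcol => a; apply/F12/rtrans_sub/enum_valP. Qed.

Lemma blockrow_mulmx N p (F : T -> 'M[algC]_(d, N)) (A : 'M_(N, p)) :
  blockrow F *m A = blockrow (fun x => F x *m A).
Proof. exact: mxcol_mul. Qed.

Lemma ind_mul_blockrow N (F : T -> 'M[algC]_(d, N)) g : equivariant F -> g \in G ->
  ind g *m blockrow F = blockrow (fun x => F (x * g)%g).
Proof.
move=> eF gG; rewrite /ind_rep /blockrow mul_mxblock_mxrow; apply: eq_mxcol => a.
have agG : (enum_val a * g)%g \in G by apply: groupM gG; apply/rtrans_sub/enum_valP.
have cX := coset_rep_mem agG.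
rewrite (bigD1 (enum_rank_in cX (coset_rep (enum_val a * g)))) //= enum_rankK_in //.
rewrite -/(coset_rep _) eqxx big1 ?addr0; last first.
  move=> b ne_b; case: eqP => [b_rep|_]; last by rewrite mul0mx.
  by case/eqP: ne_b; apply: enum_val_inj; rewrite enum_rankK_in.
by rewrite -(eF _ _ (mul_coset_repV agG) (rtrans_sub cX)) mulgKV.
Qed.

Lemma equivariant_submx N (F : T -> 'M[algC]_(d, N)) x :
  equivariant F -> x \in G -> (F x <= blockrow F)%MS.
Proof.
move=> eF xG; have cX := coset_rep_mem xG.
have -> : F x = sigma (x * (coset_rep x)^-1)%g
                *m submxcol (blockrow F) (enum_rank_in cX (coset_rep x)).
  by rewrite mxcolK enum_rankK_in // -eF ?mulgKV ?mul_coset_repV ?(rtrans_sub cX).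
by apply: mulmx_sub; rewrite -{1}[blockrow F]mul1mx -submxcol_mul submxMl.
Qed.

Definition ind_row (z : T) : 'M[algC]_(d, \sum_(a < #|X|) d) :=
  \mxrow_(b < #|X|)
    (if enum_val b == coset_rep z then sigma (z * (enum_val b)^-1)%g else 0).

Lemma ind_repE g : ind g = blockrow (fun x => ind_row (x * g)%g).
Proof. exact: mxblockEv. Qed.

Lemma ind_row_equivariant : equivariant ind_row.
Proof.
move=> h z hH zG; rewrite /ind_row mul_mxrow; apply: eq_mxrow => b.
rewrite coset_repM //; case: eqP => [->|_]; last by rewrite mulmx0.
by case: sigmaP => _ sigmaM; rewrite -mulgA (sigmaM _ _ hH (mul_coset_repV zG)).
Qed.

Lemma blockrow_ind_row : blockrow ind_row = 1%:M.
Proof.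
rewrite -mxdiagZ /blockrow /ind_row -mxblockEv; apply: eq_mxblock => a b.
rewrite coset_rep_id ?enum_valP // eq_sym (inj_eq enum_val_inj) conform_mx_id.
by case: eqP => // <-; case: sigmaP => sigma1 _; rewrite mulgV sigma1.
Qed.

Lemma ind_rep_repr : mx_repr G ind.
Proof.
split=> [|x y xG yG].
  by rewrite ind_repE -blockrow_ind_row; apply: eq_blockrow => x _; rewrite mulg1.
rewrite (ind_repE y) ind_mul_blockrow //; last first.
  by move=> h z hH zG; rewrite -mulgA ind_row_equivariant ?groupM.
by rewrite ind_repE; apply: eq_blockrow => z _; rewrite mulgA.
Qed.

End InducedRepresentation.

(** * The hyperoctahedral group *)

Lemma Bn_group_set n : group_set (Bn n).
Proof.
apply/group_setP; split; first by rewrite inE; apply/forallP => x; rewrite !perm1.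
move=> p q; rewrite !inE => /forallP pN /forallP qN; apply/forallP => x.
by rewrite !permM (eqP (pN x)) (eqP (qN _)).
Qed.
Canonical Bn_group n := Group (Bn_group_set n).

Lemma Sn_group_set n : group_set (Sn n).
Proof.
apply/group_setP; split=> [|p q].
  by rewrite inE (group1 (Bn_group n)); apply/forallP => x; rewrite !perm1.
rewrite [p \in _]inE [q \in _]inE => /andP[pB /forallP p2] /andP[qB /forallP q2].
rewrite inE (groupM (G := Bn_group n)) //=; apply/forallP => x.
by rewrite permM (eqP (q2 _)).
Qed.
Canonical Sn_group n := Group (Sn_group_set n).

Lemma Sn_sub n : Sn n \subset Bn n.
Proof. by apply/subsetP => p; rewrite inE => /andP[]. Qed.

Section Hyperoctahedral.
Variable n : nat.
Implicit Types (i j k : 'I_n) (b : bool) (p t : gT n) (A : {set 'I_n}).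

Lemma BnP t : reflect (forall x, t (negs x) = negs (t x)) (t \in Bn n).
Proof. by rewrite inE; apply: (iffP forallP) => tN x; apply/eqP/tN. Qed.

Lemma Bn_pairE t k b :
  t \in Bn n -> t (k, b) = ((t (k, false)).1, (t (k, false)).2 (+) b).
Proof.
move/BnP => tN; case: b; last by rewrite addbF -surjective_pairing.
by rewrite addbT; exact: tN (k, false).
Qed.

Lemma SnP t : reflect (t \in Bn n /\ forall x, (t x).2 = x.2) (t \in Sn n).
Proof.
rewrite [t \in Sn n]inE; apply: (iffP andP) => -[tB t2]; split=> //.
  by move=> x; apply/eqP/(forallP t2).
by apply/forallP => x; rewrite t2.
Qed.

Lemma sgenE i k b : sgen i (k, b) =
  if i == 0%N :> nat then (k, b (+) (k == i)) else (tperm (predo i) i k, b).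
Proof.
have ne_sign k1 k2 b1 : (k1, b1) != (k2, ~~ b1) by case: b1; rewrite xpair_eqE andbF.
rewrite /sgen; case: ifP => _.
  case: (eqVneq k i) => [->|ne_ki]; first by case: b; rewrite ?tpermL ?tpermR.
  by rewrite tpermD ?addbF // xpair_eqE negb_and eq_sym ne_ki.
rewrite permM; case: tpermP => [->|->|/eqP ne_kpi /eqP ne_ki].
- by case: b; rewrite ?tpermL (tpermD (ne_sign _ _ _) (ne_sign _ _ _)) ?tpermL.
- by case: b; rewrite ?tpermR (tpermD (ne_sign _ _ _) (ne_sign _ _ _)) ?tpermR.
by rewrite !tpermD // xpair_eqE negb_and eq_sym ?ne_kpi ?ne_ki.
Qed.

Lemma sgen_fix i k b :
  k != i.-1 :> nat -> k != i :> nat -> sgen i (k, b) = (k, b).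
Proof.
move=> ne_kpi ne_ki; rewrite sgenE -(inj_eq val_inj) (negPf ne_ki) addbF.
by case: ifP => // _; rewrite tpermD // -(inj_eq val_inj) eq_sym.
Qed.

Lemma sgen_predo i b : (0 < i)%N -> sgen i (predo i, b) = (i, b).
Proof. by move=> i0; rewrite sgenE gtn_eqF // tpermL. Qed.

Lemma sgen_self i b : (0 < i)%N -> sgen i (i, b) = (predo i, b).
Proof. by move=> i0; rewrite sgenE gtn_eqF // tpermR. Qed.

Lemma sgen_self0 i b : i = 0%N :> nat -> sgen i (i, b) = (i, ~~ b).
Proof. by move=> i0; rewrite sgenE i0 !eqxx addbT. Qed.

Lemma sgen_sq i : (sgen i * sgen i = 1)%g.
Proof.
apply/permP => -[k b]; rewrite permM perm1 !sgenE.
by case: ifP => i0; rewrite sgenE i0 ?tpermK // -addbA addbb addbF.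
Qed.

Lemma sgenV i : ((sgen i)^-1 = sgen i)%g.
Proof. by apply/eqP; rewrite eq_invg_mul sgen_sq. Qed.

Lemma sgenK i : involutive (sgen i).
Proof. by move=> x; rewrite -permM sgen_sq perm1. Qed.

Lemma sgen_Bn i : sgen i \in Bn n.
Proof. by apply/BnP => -[k b]; rewrite /negs /= !sgenE; case: ifP; rewrite //= addNb. Qed.

Lemma sgen_Sn i : (0 < i)%N -> sgen i \in Sn n.
Proof. by move=> i0; apply/SnP; split=> [|[k b]]; rewrite ?sgen_Bn // sgenE gtn_eqF. Qed.

Lemma sgen_conj j p : (0 < j)%N -> (sgen j ^ p)%g =
  (tperm (p (predo j, false)) (p (j, false)) * tperm (p (predo j, true)) (p (j, true)))%g.
Proof. by move=> j0; rewrite /sgen gtn_eqF // conjMg !tpermJ. Qed.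

Lemma sgen_comm i j : (i.+1 < j)%N -> (sgen i * sgen j = sgen j * sgen i)%g.
Proof.
move=> ij; have j0 : (0 < j)%N by lia.
suff jJ : (sgen j ^ sgen i = sgen j)%g by apply/esym/commgP/conjg_fixP.
rewrite sgen_conj // !sgen_fix; first by rewrite /sgen gtn_eqF.
all: by rewrite /=; lia.
Qed.

Lemma sgen_braid3 i : (1 < i)%N ->
  (sgen (predo i) * sgen i * sgen (predo i) = sgen i * sgen (predo i) * sgen i)%g.
Proof.
move=> i1; have [i0 pi0] : (0 < i /\ 0 < predo i)%N by split=> /=; lia.
suff : (sgen i ^ sgen (predo i) = sgen (predo i) ^ sgen i)%g.
  by rewrite !conjgE !sgenV !mulgA.
rewrite !sgen_conj // !sgen_self // !sgen_predo // !sgen_fix //.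
all: by rewrite /=; lia.
Qed.

Lemma sgen_braid4 i : i = 1%N :> nat ->
  (sgen (predo i) * sgen i * sgen (predo i) * sgen i =
   sgen i * sgen (predo i) * sgen i * sgen (predo i))%g.
Proof.
move=> i1; have [i0 pi0] : (0 < i)%N /\ predo i = 0%N :> nat by split=> /=; lia.
have conj0 : (sgen (predo i) ^ sgen i = tperm (i, false) (i, true))%g.
  by rewrite {1}/sgen pi0 eqxx tpermJ !sgen_predo.
suff : (sgen (predo i) * sgen (predo i) ^ sgen i =
        sgen (predo i) ^ sgen i * sgen (predo i))%g.
  by rewrite conjgE sgenV !mulgA.
apply/esym/commgP/conjg_fixP; rewrite conj0 tpermJ !sgen_fix //.
all: by rewrite /=; lia.
Qed.

(* [j \in neg_set t] when [- (j + 1)] is the image under [t] of a positive integer. *)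
Definition neg_set t : {set 'I_n} := [set j | (t^-1%g (j, false)).2].

Definition flip_fun A (x : sgn_elt n) : sgn_elt n := (x.1, x.2 (+) (x.1 \in A)).

Lemma flip_funK A : involutive (flip_fun A).
Proof. by case=> k b; rewrite /flip_fun /= -addbA addbb addbF. Qed.

Definition flip A : gT n := perm (inv_inj (flip_funK A)).

Lemma flipE A k b : flip A (k, b) = (k, b (+) (k \in A)).
Proof. by rewrite permE. Qed.

Lemma flip_Bn A : flip A \in Bn n.
Proof. by apply/BnP => -[k b]; rewrite /negs !flipE /= addNb. Qed.

Lemma neg_set1 : neg_set 1%g = set0.
Proof. by apply/setP => j; rewrite !inE invg1 perm1. Qed.

Lemma flip0 : flip set0 = 1%g.
Proof. by apply/permP => -[k b]; rewrite flipE perm1 inE addbF. Qed.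

Lemma mul_flip_neg_set t : t \in Bn n -> (t * flip (neg_set t))%g \in Sn n.
Proof.
move=> tB; apply/SnP; split=> [|[k b]]; first by rewrite groupM ?flip_Bn.
rewrite permM; case def_t: (t (k, b)) => [j c]; rewrite flipE inE /=.
have : t^-1%g (j, c) = (k, b) by rewrite -def_t permK.
by rewrite (Bn_pairE _ c) ?groupV // => -[_ <-]; rewrite addbC.
Qed.

Lemma neg_set_mul_Sn p t : p \in Sn n -> neg_set (p * t)%g = neg_set t.
Proof.
rewrite -groupV => /SnP[_ p2].
by apply/setP => j; rewrite !inE invMg permM p2.
Qed.

Lemma neg_set_mul_sgen i t : (0 < i)%N ->
  neg_set (t * sgen i)%g = tperm (predo i) i @^-1: neg_set t.
Proof. by move=> i0; apply/setP => j; rewrite !inE invMg permM sgenV sgenE gtn_eqF. Qed.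

Lemma neg_set_mul_sgen0 i t : t \in Bn n -> i = 0%N :> nat ->
  neg_set (t * sgen i)%g = toggle i (neg_set t).
Proof.
move=> tB i0; apply/setP => j.
by rewrite in_toggle !inE invMg permM sgenV sgenE i0 /= Bn_pairE ?groupV.
Qed.

Lemma sgen_mul_flip i A : (0 < i)%N ->
  (sgen i * flip (tperm (predo i) i @^-1: A) = flip A * sgen i)%g.
Proof.
move=> i0; apply/permP => -[k b].
by rewrite !permM flipE !sgenE gtn_eqF // flipE inE tpermK.
Qed.

Lemma sgen_mul_flip0 i A : i = 0%N :> nat ->
  (sgen i * flip (toggle i A) = flip A)%g.
Proof.
move=> i0; apply/permP => -[k b].
by rewrite permM !flipE sgenE i0 eqxx flipE in_toggle -addbA [_ (+) (k == i)]addbC addKb.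
Qed.

Lemma card_rtrans_le : (#|rtrans (Bn n) (Sn n)| <= 2 ^ n)%N.
Proof.
have -> : (2 ^ n = #|{set 'I_n}|)%N.
  by rewrite -cardsT -powersetT card_powerset cardsT card_ord.
rewrite -(@card_in_imset _ _ neg_set) ?max_card // => x y xX yX eq_xy.
have [xB yB] := (rtrans_sub (Sn_sub n) xX, rtrans_sub (Sn_sub n) yX).
apply: (pblock_inj (rtransP (Sn_sub n)) xX yX).
rewrite !pblock_rcosets ?Sn_sub //; apply/rcoset_eqP; rewrite mem_rcoset.
have := groupM (mul_flip_neg_set xB) (groupVr (mul_flip_neg_set yB)).
by rewrite invMg eq_xy !mulgA mulgK.
Qed.

End Hyperoctahedral.

Section FrobeniusReciprocity.
Variables (n d N : nat) (M : 'I_n -> 'M[algC]_N).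
Variables (sigma : gT n -> 'M[algC]_d) (P : 'M[algC]_(d, N)).
Hypotheses (coxM : coxeterB_relations M) (sigmaP : mx_repr (Sn n) sigma).
Hypothesis P_intertwines :
  forall i : 'I_n, (0 < i)%N -> sigma (sgen i) *m P = P *m M i.

Definition frob (t : gT n) : 'M[algC]_(d, N) :=
  sigma (t * flip (neg_set t))%g *m P *m sign_change M (neg_set t).

Definition frobmx : 'M[algC]_(\sum_(a < #|rtrans (Bn n) (Sn n)|) d, N) :=
  blockrow (Bn_group n) (Sn_group n) frob.

Lemma frob1 : frob 1%g = P.
Proof.
case: sigmaP => sigma1 _; rewrite /frob neg_set1 flip0 mulg1 sigma1 mul1mx.
by rewrite /sign_change enum_set0 big_nil mulmx1.
Qed.

Lemma frob_equivariant : equivariant (Bn_group n) (Sn_group n) sigma frob.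
Proof.
move=> h x hS xB; case: sigmaP => _ sigmaM.
by rewrite /frob neg_set_mul_Sn // -mulgA sigmaM ?mul_flip_neg_set // !mulmxA.
Qed.

Lemma frob_mul_sgen (i : 'I_n) t : t \in Bn n -> frob (t * sgen i)%g = frob t *m M i.
Proof.
move=> tB; rewrite /frob -!mulmxA -mulgA mulmxE; have [i0|i0] := posnP i.
  by rewrite neg_set_mul_sgen0 // sgen_mul_flip0 // sign_change_mul0.
case: sigmaP => _ sigmaM.
rewrite neg_set_mul_sgen // sgen_mul_flip // mulgA sigmaM ?mul_flip_neg_set ?sgen_Sn //.
by rewrite sign_change_mul // -mulmxE -!mulmxA (mulmxA _ P) P_intertwines // !mulmxA.
Qed.

Lemma ind_mul_frobmx (i : 'I_n) :
  ind_rep (Bn n) (Sn n) sigma (sgen i) *m frobmx = frobmx *m M i.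
Proof.
rewrite (ind_mul_blockrow (Sn_sub n) frob_equivariant) ?sgen_Bn // blockrow_mulmx.
by apply: (eq_blockrow (Sn_sub n)) => t; apply: frob_mul_sgen.
Qed.

Lemma frobmx_stable (i : 'I_n) : stablemx frobmx (M i).
Proof. by rewrite -ind_mul_frobmx submxMl. Qed.

Lemma submx_frobmx : (P <= frobmx)%MS.
Proof. by rewrite -frob1 (equivariant_submx (Sn_sub n) frob_equivariant) ?group1. Qed.

End FrobeniusReciprocity.

(** * Standard fillings of a skew shape *)

Section StandardFillings.
Variables mu nu : seq nat.
Local Notation cell := ('I_(size mu) * 'I_(head 0%N mu))%type.
Implicit Types b : cell.

Definition precedes b1 b2 : bool :=
  (b1.1 == b2.1) && (b1.2 < b2.2)%N || (b1.2 == b2.2) && (b1.1 < b2.1)%N.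

(* [c k] is the box labelled [k] and [e k] the entry written in it. *)
Definition standard (I : Type) disp (E : porderType disp) (c : I -> cell) (e : I -> E) :
    Prop :=
  [/\ injective c, forall k, in_shape nu (c k),
      forall b, in_shape nu b -> exists k, c k = b
    & forall k l, precedes (c k) (c l) -> (e k < e l)%O].

Lemma standardP (I : finType) disp (E : porderType disp) (c : I -> cell) (e : I -> E) :
  reflect (standard c e)
    [&& injectiveb c, [forall k, in_shape nu (c k)],
        [forall b, in_shape nu b ==> (b \in codom c)],
        [forall k, forall l, same_row (c k) (c l) ==>
           ((c k).2 < (c l).2)%N ==> (e k < e l)%O]
      & [forall k, forall l, same_col (c k) (c l) ==>
           ((c k).1 < (c l).1)%N ==> (e k < e l)%O]].
Proof.
apply: (iffP and5P) => [|[c_inj c_in c_surj ce]]; last first.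
  split; first exact/injectiveP.
  - exact/forallP.
  - by apply/forallP => b; apply/implyP => /c_surj[k <-]; apply: codom_f.
  - apply/'forall_'forall_implyP => k l kl; apply/implyP => lt_kl; apply: ce.
    by rewrite /precedes [_ == _]kl lt_kl.
  apply/'forall_'forall_implyP => k l kl; apply/implyP => lt_kl; apply: ce.
  by rewrite /precedes [(c k).2 == _]kl lt_kl orbT.
case=> /injectiveP c_inj /forallP c_in /forallP c_surj /'forall_'forall_implyP rows.
move=> /'forall_'forall_implyP cols; split=> // [b b_in | k l].
  by have /implyP/(_ b_in)/codomP[k ->] := c_surj b; exists k.
case/orP=> /andP[kl lt_kl]; first exact: (implyP (rows k l kl)).
exact: (implyP (cols k l kl)).
Qed.

Lemma standard_transfer (I J : Type) disp1 disp2 (E1 : porderType disp1)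
    (E2 : porderType disp2) (t : J -> I) (c1 : I -> cell) (e1 : I -> E1)
    (c2 : J -> cell) (e2 : J -> E2) :
  bijective t -> c2 =1 c1 \o t ->
  (forall k l, precedes (c1 (t k)) (c1 (t l)) -> (e1 (t k) < e1 (t l))%O ->
     (e2 k < e2 l)%O) ->
  standard c1 e1 -> standard c2 e2.
Proof.
move=> [u tK uK] c21 e12 [c1_inj c1_in c1_surj c1e1]; split.
- by move=> k l; rewrite !c21 => /c1_inj/(can_inj tK).
- by move=> k; rewrite c21; apply: c1_in.
- by move=> b /c1_surj[k <-]; exists (u k); rewrite c21 /= uK.
by move=> k l; rewrite !c21 => kl; apply: e12 => //; apply: c1e1.
Qed.

Hypothesis skew : is_skew_shape mu nu.

Lemma in_shape_convex b1 b2 b : in_shape nu b1 -> in_shape nu b2 ->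
  (b1.1 <= b.1)%N -> (b1.2 <= b.2)%N -> (b.1 <= b2.1)%N -> (b.2 <= b2.2)%N ->
  in_shape nu b.
Proof.
have nth_geq (s : seq nat) r1 r2 :
    sorted geq s -> (r1 <= r2)%N -> (nth 0 s r2 <= nth 0 s r1)%N.
  move=> s_sorted r12; have [r2s|/(nth_default 0)->//] := ltnP r2 (size s).
  have geq_trans : transitive geq by move=> x y z /= yx zx; apply: leq_trans yx.
  apply: (sorted_leq_nth geq_trans leqnn) => //; rewrite inE //.
  exact: leq_ltn_trans r2s.
case: skew => mu_sorted [nu_sorted _] /andP[nu_b1 _] /andP[_ mu_b2] r1 c1 r2 c2.
apply/andP; split.
  exact: leq_trans (nth_geq _ _ _ nu_sorted r1) (leq_trans nu_b1 c1).
exact: leq_ltn_trans c2 (leq_trans mu_b2 (nth_geq _ _ _ mu_sorted r2)).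
Qed.

Lemma precedes_cover b1 b2 : in_shape nu b1 -> in_shape nu b2 -> precedes b1 b2 ->
  (content b2 - content b1) ^+ 2 = 1 \/
  exists b, [/\ in_shape nu b, precedes b1 b & precedes b b2].
Proof.
move=> in_b1 in_b2 /orP[] /andP[/eqP e12 lt12]; rewrite /content -?e12.
  have [adjacent|apart] : (b2.2 = b1.2.+1 :> nat \/ b1.2.+1 < b2.2)%N by lia.
    by left; rewrite adjacent; ring.
  right; exists (b1.1, Ordinal (leq_ltn_trans lt12 (ltn_ord b2.2))).
  rewrite /precedes /= e12 !eqxx ltnSn apart; split=> //.
  by apply: (in_shape_convex in_b1 in_b2) => /=; rewrite ?e12 //; lia.
have [adjacent|apart] : (b2.1 = b1.1.+1 :> nat \/ b1.1.+1 < b2.1)%N by lia.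
  by left; rewrite adjacent; ring.
right; exists (Ordinal (leq_ltn_trans lt12 (ltn_ord b2.1)), b1.2).
rewrite /precedes /= e12 !eqxx ltnSn apart !orbT; split=> //.
by apply: (in_shape_convex in_b1 in_b2) => /=; rewrite ?e12 //; lia.
Qed.

Section Entries.
Variables (I : Type) (disp : Order.disp_t) (E : porderType disp).
Variables (c : I -> cell) (e : I -> E).
Hypothesis std : standard c e.

Definition between (x y z : E) : bool := (x < z < y)%O || (y < z < x)%O.

Lemma standard_adjacent k l : precedes (c k) (c l) ->
  (forall p, ~~ (e k < e p < e l)%O) -> (content (c l) - content (c k)) ^+ 2 = 1.
Proof.
case: std => c_inj c_in c_surj ce kl no_between.
have [//|[b [/c_surj[p <-] kp pl]]] := precedes_cover (c_in k) (c_in l) kl.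
by case/negP: (no_between p); rewrite !ce.
Qed.

(* The other two corners of the rectangle spanned by two boxes of the same
   diagonal hold intermediate entries. *)
Lemma standard_diagonal k l : k <> l -> content (c k) = content (c l) ->
  exists p q, [/\ p <> q, between (e k) (e l) (e p) & between (e k) (e l) (e q)].
Proof.
case: std => c_inj c_in c_surj ce.
wlog lt_kl : k l / ((c k).1 < (c l).1)%N => [IH ne_kl eq_kl|].
  have [lt_kl|lt_lk|eq_row] := ltngtP (c k).1 (c l).1; first exact: IH.
    have [p [q [ne_pq kpl kql]]] := IH l k lt_lk (nesym ne_kl) (esym eq_kl).
    by exists p, q; split=> //; rewrite /between orbC.
  case: ne_kl; apply: c_inj; rewrite [c k]surjective_pairing [c l]surjective_pairing.
  congr (_, _); apply: val_inj; first exact: eq_row.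
  by move: eq_kl; rewrite /content eq_row /=; lia.
move=> _ eq_kl; have lt_col : ((c k).2 < (c l).2)%N by move: eq_kl; rewrite /content; lia.
have [p cp] : exists p, c p = ((c k).1, (c l).2).
  by apply/c_surj/(in_shape_convex (c_in k) (c_in l)) => //=; apply: ltnW.
have [q cq] : exists q, c q = ((c l).1, (c k).2).
  by apply/c_surj/(in_shape_convex (c_in k) (c_in l)) => //=; apply: ltnW.
exists p, q; split.
- by move=> eq_pq; move: cp; rewrite eq_pq cq => -[/(congr1 val) /=]; lia.
- by apply/orP; left; rewrite !ce // /precedes cp /= eqxx ?lt_kl ?lt_col ?orbT.
by apply/orP; left; rewrite !ce // /precedes cq /= eqxx ?lt_kl ?lt_col ?orbT.
Qed.

End Entries.

End StandardFillings.

Section Rank.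
Variables (n : nat) (disp : Order.disp_t) (E : orderType disp) (e : 'I_n -> E).

Lemma card_below_lt k : (#|[set l | (e l < e k)%O]| < n)%N.
Proof.
rewrite -[X in (_ < X)%N]card_ord -cardsT; apply/proper_card/properP.
by split; [exact: subsetT | exists k; rewrite !inE ?ltxx].
Qed.

Definition order_rank k : 'I_n := Ordinal (card_below_lt k).

Lemma lt_order_rank k l : (order_rank k < order_rank l)%N = (e k < e l)%O.
Proof.
have [lt_kl|le_lk] := ltP (e k) (e l).
  apply/proper_card/properP; split; last by exists k; rewrite !inE ?ltxx.
  by apply/subsetP => j; rewrite !inE => /lt_trans; apply.
apply/negbTE; rewrite -leqNgt; apply/subset_leq_card/subsetP => j.
by rewrite !inE => /lt_le_trans; apply.
Qed.

Lemma order_rank_inj : injective e -> injective order_rank.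
Proof.
move=> e_inj k l eq_kl; apply: e_inj.
by apply/le_anti; rewrite !leNgt -!lt_order_rank eq_kl ltnn.
Qed.

End Rank.

(** * Standard B-Young tableaux *)

Local Notation signed_value := Defs.sval.

Lemma signed_value_inj n : injective (@signed_value n).
Proof.
move=> [k b] [l b']; rewrite /signed_value /= => eq_kl.
have [eq_b eq_val] : b = b' /\ k = l :> nat by move: b b' eq_kl => [] [] /=; lia.
by rewrite eq_b (val_inj eq_val).
Qed.

Lemma signed_value_sgen_mono n (i : 'I_n) (x y : sgn_elt n) :
  y != sgen i x -> signed_value x < signed_value y ->
  signed_value (sgen i x) < signed_value (sgen i y).
Proof.
case: x y => [k b] [l b']; rewrite !sgenE.
case: ifP => [/eqP i0|/negbT i0]; rewrite xpair_eqE.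
  rewrite /signed_value -!(inj_eq (@ord_inj n)) /= i0.
  move: (nat_of_ord k) (nat_of_ord l) => {}k {}l.
  by case: b; case: b'; case: k => [|k]; case: l => [|l] /=; lia.
have ordE (j1 j2 : 'I_n) : j1 <> j2 -> nat_of_ord j1 <> j2 by move=> ne /val_inj.
rewrite -(inj_eq (@ord_inj n)) /signed_value.
by case: tpermP => [->|->|/ordE /= ? /ordE ?];
  case: tpermP => [->|->|/ordE /= ? /ordE ?]; case: b; case: b' => /=; lia.
Qed.

Lemma signed_value_sgen_adjacent n (i : 'I_n) (x z : sgn_elt n) :
  ~~ (signed_value x < signed_value z < signed_value (sgen i x)).
Proof.
case: x => k b; rewrite sgenE; case: ifP => [/eqP i0|/negbT i0].
  rewrite /signed_value -!(inj_eq (@ord_inj n)) /= i0.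
  by case: b; case: z.2; case: (nat_of_ord k) => [|j] /=; lia.
by rewrite /signed_value; case: tpermP => [->|->|_ _]; case: b; case: z.2 => /=; lia.
Qed.

Lemma min_content_le mu nu (b : 'I_(size mu) * 'I_(head 0%N mu)) :
  in_shape nu b -> min_content mu nu <= content b.
Proof.
move=> b_in; rewrite /min_content foldrE; apply: ge_bigmin_seq => //.
by apply/mapP; exists b; rewrite // mem_filter b_in mem_enum inE.
Qed.

Section BTableaux.
Variables (mu nu : seq nat) (n m : nat).
Local Notation btab := (btab mu n).
Local Notation BT := (BT mu nu n).
Implicit Types (T : btab) (i j k l : 'I_n) (p : gT n) (x y : sgn_elt n).

Definition sgn_entry T k : sgn_elt n := (k, (T k).2).

Lemma BTP T : reflect (standard nu (bcell T) (bentry T)) (T \in BT).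
Proof. by rewrite inE; apply: standardP. Qed.

(* The box holding [+-(k + 1)] in [T^p] holds [+-(origin p k + 1)] in [T]. *)
Definition origin p k : 'I_n := (p^-1%g (k, false)).1.

Lemma perm_origin p k b :
  p \in Bn n -> p (origin p k, b) = (k, (p^-1%g (k, false)).2 (+) b).
Proof.
move=> pB; have pV : p^-1%g \in Bn n by rewrite groupV.
apply: (@perm_inj _ p^-1%g); rewrite permK (Bn_pairE _ (_ (+) b)) // -/(origin p k).
by rewrite addbA addbb.
Qed.

Lemma origin_bij p : p \in Bn n -> bijective (origin p).
Proof.
move=> pB; apply: injF_bij; apply: (can_inj (g := fun j => (p (j, false)).1)) => k.
by rewrite perm_origin.
Qed.

Lemma bcell_act p T k : bcell (btab_act p T) k = bcell T (origin p k).
Proof. by rewrite /bcell ffunE. Qed.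

Lemma sgn_entry_act p T k : p \in Bn n ->
  sgn_entry (btab_act p T) k = p (sgn_entry T (origin p k)).
Proof. by move=> pB; rewrite perm_origin // /sgn_entry ffunE addbC. Qed.

Lemma btab_actM p q T :
  p \in Bn n -> q \in Bn n -> btab_act (p * q)%g T = btab_act q (btab_act p T).
Proof.
move=> pB qB; apply/ffunP => k; rewrite !ffunE /= invMg permM.
case: (q^-1%g _) => l b /=; rewrite (Bn_pairE _ b) ?groupV //=.
by rewrite ffunE /= addbA.
Qed.

Lemma btab_act1 T : btab_act 1%g T = T.
Proof. by apply/ffunP => k; rewrite ffunE invg1 perm1 /= addbF -surjective_pairing. Qed.

Lemma btab_act_BT p T : p \in Bn n -> T \in BT ->
  (forall k l, precedes (bcell T k) (bcell T l) -> bentry T k < bentry T l ->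
     signed_value (p (sgn_entry T k)) < signed_value (p (sgn_entry T l))) ->
  btab_act p T \in BT.
Proof.
move=> pB /BTP std p_mono; apply/BTP.
apply: standard_transfer (origin_bij pB) (bcell_act p T) _ std => k l kl lt_kl.
rewrite -![bentry _ _]/(signed_value (sgn_entry _ _)) !sgn_entry_act //.
exact: p_mono.
Qed.

(* Twice the content of the box that contains [x] in the full symmetric
   diagram; doubling makes it an (odd) integer. *)
Definition content2 T x : int :=
  let z := 2 * (content (bcell T x.1) - min_content mu nu + m%:Z) + 1 in
  if x.2 (+) (T x.1).2 then - z else z.

Lemma content2_negs T x : content2 T (negs x) = - content2 T x.
Proof.
by case: x => k b; rewrite /content2 /= addNb; case: (b (+) _); rewrite ?opprK.
Qed.

Lemma content2_act p T x :
  p \in Bn n -> content2 (btab_act p T) x = content2 T (p^-1%g x).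
Proof.
move=> pB; case: x => k b; rewrite (Bn_pairE _ b) ?groupV // /content2 /=.
by rewrite bcell_act ffunE /= (addbC (T _).2) addbA (addbC b).
Qed.

Lemma content2_bound T x : T \in BT -> (0 < m)%N ->
  if x.2 (+) (T x.1).2 then content2 T x <= -3 else 3 <= content2 T x.
Proof.
move=> /BTP[_ in_T _ _] m0; have := min_content_le (in_T x.1).
by rewrite /content2; case: (_ (+) _); lia.
Qed.

Hypothesis skew : is_skew_shape mu nu.

Local Notation bf := (@bf mu nu n m).
Local Notation M := (@btab_mx mu nu n m).

Definition content_gap T x y : algC := (content2 T x - content2 T y)%:~R / 2.

Lemma content_gapN T x y : - content_gap T x y = content_gap T y x.
Proof. by rewrite /content_gap -mulNr -rmorphN /= opprB. Qed.

Lemma content_gapD T x y z : content_gap T x y + content_gap T y z = content_gap T x z.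
Proof. by rewrite /content_gap -mulrDl -rmorphD /= addrA subrK. Qed.

Lemma content_gap_negs T x y : content_gap T (negs x) (negs y) = content_gap T y x.
Proof. by rewrite /content_gap !content2_negs opprK addrC. Qed.

Lemma content_gap_act p T x y : p \in Bn n ->
  content_gap (btab_act p T) x y = content_gap T (p^-1%g x) (p^-1%g y).
Proof. by move=> pB; rewrite /content_gap !content2_act. Qed.

Lemma sqr_content_gap_eq1 T x y :
  (content_gap T x y ^+ 2 == 1) = ((content2 T x - content2 T y) ^+ 2 == 4).
Proof.
rewrite expr_div_n -[X in _ == X]divr1 eqr_div ?oner_neq0 ?expf_neq0 ?pnatr_eq0 //.
rewrite mulr1 mul1r -rmorphXn /=.
by rewrite -natrX (_ : (2 ^ 2)%:R = (4 : int)%:~R) // eqr_int.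
Qed.

Lemma bfE i T : bf i T = content_gap T (i, false) (sgen i (i, false)).
Proof.
have bcE k : bc nu m T k = (content2 T (k, false))%:~R / 2.
  rewrite /bc /content2 /bcontent_cell /=; set z := _ + m%:Z; move: z => z.
  by case: (T k).2; rewrite ?rmorphN /= (rmorphD _ (2 * z)) rmorphM /=; field.
rewrite /bf /content_gap !bcE; have [i0|i0] := posnP i.
  rewrite sgen_self0 // -[(i, ~~ false)]/(negs (i, false)) content2_negs opprK.
  by rewrite rmorphD /=; field.
by rewrite sgen_self // rmorphB /=; field.
Qed.

Lemma sqr_bf i T x :
  sgen i x != x -> bf i T ^+ 2 = content_gap T x (sgen i x) ^+ 2.
Proof.
rewrite bfE; set y := (i, false).
suff : sgen i x != x -> [\/ x = y, x = sgen i y, x = negs y | x = negs (sgen i y)].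
  have sgenN := BnP _ (sgen_Bn i).
  by move=> + ne_x => /(_ ne_x)[] ->; rewrite ?sgenN ?sgenK ?content_gap_negs //;
    rewrite -content_gapN sqrrN.
rewrite /y; case: x => k b; have [->|ne_ki] := eqVneq k i.
  by case: b; [constructor 3 | constructor 1].
have [eq_k|ne_kpi] := eqVneq k (predo i); last by rewrite sgen_fix ?eqxx.
have [i0|i0] := posnP i; last first.
  by rewrite eq_k sgen_self //; case: b; [constructor 4 | constructor 2].
by case/eqP: ne_ki; apply: val_inj; rewrite eq_k /= i0.
Qed.

Definition bswap i T : btab := btab_act (sgen i) T.

Lemma bswapK i : involutive (bswap i).
Proof. by move=> T; rewrite /bswap -btab_actM ?sgen_Bn // sgen_sq btab_act1. Qed.

Lemma content_gap_bswap i T x y :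
  content_gap (bswap i T) x y = content_gap T (sgen i x) (sgen i y).
Proof. by rewrite /bswap content_gap_act ?sgen_Bn // sgenV. Qed.

Lemma bf_bswap i T : bf i (bswap i T) = - bf i T.
Proof. by rewrite !bfE content_gap_bswap sgenK content_gapN. Qed.

Lemma bswap_BT i T : T \in BT -> bf i T ^+ 2 != 1 -> bswap i T \in BT.
Proof.
move=> TB f_neq1; have /BTP std := TB.
apply: btab_act_BT TB _ => [|k l kl lt_kl]; first exact: sgen_Bn.
apply: signed_value_sgen_mono lt_kl; apply: contraNneq f_neq1 => eq_l.
have ne_kl : sgen i (sgn_entry T k) != sgn_entry T k.
  rewrite -eq_l; apply/eqP => -[eq_kl _]; move: kl.
  by rewrite eq_kl /precedes !ltnn !andbF.
have adjacent : (content (bcell T l) - content (bcell T k)) ^+ 2 = 1.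
  apply: (standard_adjacent skew std kl) => q.
  by rewrite /bentry eq_l signed_value_sgen_adjacent.
rewrite (sqr_bf T ne_kl) -eq_l sqr_content_gap_eq1 /content2 /= !addbb; lia.
Qed.

(* The zero vector when [T] is not standard. *)
Definition bvec T : 'rV[algC]_#|BT| := \row_b (enum_val b == T)%:R.

Lemma bvec_out T : T \notin BT -> bvec T = 0.
Proof.
by move=> TB; apply/rowP => b; rewrite !mxE; case: eqP TB => // <-; rewrite enum_valP.
Qed.

Lemma bvec_enum_val a : bvec (enum_val a) = delta_mx 0 a.
Proof. by apply/rowP => b; rewrite !mxE (inj_eq enum_val_inj). Qed.

Lemma eq_mx_bvec q (A B : 'M[algC]_(#|BT|, q)) :
  (forall T, T \in BT -> bvec T *m A = bvec T *m B) -> A = B.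
Proof.
move=> AB; apply/row_matrixP => a; rewrite !rowE -bvec_enum_val.
exact/AB/enum_valP.
Qed.

(* For nonstandard [T] either both rows vanish or the off-diagonal coefficient does. *)
Lemma bvec_seminormal i T f :
  bf i T = f -> seminormal (M i) f (bvec T) (bvec (bswap i T)).
Proof.
move=> <-; rewrite /seminormal; have [TB|TnB] := boolP (T \in BT).
  rewrite -{1}(enum_rankK_in TB TB) bvec_enum_val -rowE.
  apply/rowP => b; rewrite !mxE (enum_rankK_in TB TB) /=.
  by rewrite mulrC [X in _ + X]mulrC.
rewrite (bvec_out TnB) mul0mx scaler0 add0r.
have [sTB|sTnB] := boolP (bswap i T \in BT); last by rewrite bvec_out // scaler0.
suff /eqP -> : offdiag (bf i T) == 0 by rewrite scale0r.
rewrite offdiag_eq0 -sqrrN -bf_bswap.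
by apply: contraNT TnB => /(bswap_BT sTB); rewrite bswapK.
Qed.

Lemma bvec_seminormalV i T f :
  bf i T = f -> seminormal (M i) (- f) (bvec (bswap i T)) (bvec T).
Proof.
move=> <-; rewrite -[in X in seminormal _ _ _ X](bswapK i T).
by apply: bvec_seminormal; rewrite bf_bswap.
Qed.

Hypothesis m0 : (0 < m)%N.

(* Boxes of equal content lie on a diagonal of the same half of the symmetric
   diagram, hence are separated by two entries of that half. *)
Lemma content2_neq T x y : T \in BT -> x != y ->
  (forall z1 z2 : sgn_elt n,
     between (signed_value x) (signed_value y) (signed_value z1) ->
     between (signed_value x) (signed_value y) (signed_value z2) -> z1.1 = z2.1) ->
  content2 T x != content2 T y.
Proof.
move=> TB ne_xy few_between; apply/eqP => eq_c; have /BTP std := TB.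
have [eq_sgn eq_content] : x.2 (+) (T x.1).2 = y.2 (+) (T y.1).2 /\
    content (bcell T x.1) = content (bcell T y.1).
  move: (content2_bound x TB m0) (content2_bound y TB m0) eq_c; rewrite /content2.
  by case: (x.2 (+) _); case: (y.2 (+) _); split=> //; lia.
pose s := x.2 (+) (T x.1).2.
have in_half z : z.2 (+) (T z.1).2 = s -> signed_value z = (-1) ^+ s * bentry T z.1.
  move=> <-; rewrite /bentry /signed_value /=.
  by case: z.2; case: (T z.1).2; rewrite /= ?mul1r ?mulN1r ?opprK.
have ne_label : x.1 <> y.1.
  move=> eq_label; case/eqP: ne_xy; apply: (@signed_value_inj n).
  by rewrite !in_half // eq_label.
have [p [q [ne_pq btw_p btw_q]]] := standard_diagonal skew std ne_label eq_content.
suff btw k : between (bentry T x.1) (bentry T y.1) (bentry T k) ->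
    between (signed_value x) (signed_value y) (signed_value (k, (T k).2 (+) s)).
  exact/ne_pq/(few_between (p, _) (q, _))/btw/btw_q/btw.
rewrite !in_half //=; last by rewrite addbAC addbb.
by rewrite /between; case: (s); rewrite ?mul1r ?mulN1r //; lia.
Qed.

Lemma content_gap_neq0 T x y : T \in BT -> x != y ->
  `|signed_value x - signed_value y| <= 2 \/
    `|signed_value x| <= 2 /\ `|signed_value y| <= 2 ->
  content_gap T x y != 0.
Proof.
move=> TB ne_xy near_xy; rewrite mulf_neq0 ?invr_eq0 ?pnatr_eq0 // intr_eq0 subr_eq0.
apply: content2_neq TB ne_xy _ => -[k1 b1] [k2 b2] btw1 btw2; apply: ord_inj.
move: btw1 btw2 near_xy; rewrite /between /signed_value /=.
by case: b1; case: b2; lia.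
Qed.

Lemma bf_neq0 i T : T \in BT -> bf i T != 0.
Proof.
move=> TB; rewrite bfE; have [i0|i0] := posnP i.
  rewrite sgen_self0 //; apply: content_gap_neq0 TB _ _; first by rewrite xpair_eqE andbF.
  by right; rewrite /signed_value /=; lia.
rewrite sgen_self //; apply: content_gap_neq0 TB _ _.
  by rewrite xpair_eqE andbT eq_sym predo_neq.
by left; rewrite /signed_value /=; lia.
Qed.

Lemma btab_mxK i : M i * M i = 1.
Proof.
apply: eq_mx_bvec => T TB; rewrite mulmx1 -mulmxE mulmxA.
exact: seminormal_involution (bf_neq0 i TB) (bvec_seminormal _) (bvec_seminormalV _).
Qed.

Lemma bf_bswap_comm i j T : (sgen i * sgen j = sgen j * sgen i)%g ->
  sgen j (i, false) = (i, false) -> bf i (bswap j T) = bf i T.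
Proof.
by move=> ij j_fix; rewrite !bfE content_gap_bswap -permM ij permM j_fix.
Qed.

Lemma btab_mx_comm i j : (i.+1 < j)%N -> GRing.comm (M i) (M j).
Proof.
move=> ij; have sC := sgen_comm ij.
apply: eq_mx_bvec => T _; rewrite -!mulmxE !mulmxA.
apply: (seminormal_comm (w := bvec (bswap j (bswap i T)))).
- exact: bvec_seminormal (erefl _).
- exact: bvec_seminormal (erefl _).
- apply: bvec_seminormal; apply: bf_bswap_comm (esym sC) _.
  by apply: sgen_fix => /=; lia.
rewrite /bswap -btab_actM ?sgen_Bn // sC btab_actM ?sgen_Bn //.
apply: bvec_seminormal; apply: bf_bswap_comm sC _.
by apply: sgen_fix => /=; lia.
Qed.

Lemma bswap_braid3 i T : (1 < i)%N ->
  bswap (predo i) (bswap i (bswap (predo i) T)) = bswap i (bswap (predo i) (bswap i T)).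
Proof.
by move=> i1; rewrite /bswap -!btab_actM ?groupM ?sgen_Bn // !mulgA sgen_braid3.
Qed.

Lemma bswap_braid4 i T : i = 1%N :> nat ->
  bswap i (bswap (predo i) (bswap i (bswap (predo i) T))) =
  bswap (predo i) (bswap i (bswap (predo i) (bswap i T))).
Proof.
by move=> i1; rewrite /bswap -!btab_actM ?groupM ?sgen_Bn // !mulgA sgen_braid4.
Qed.

Lemma btab_mx_braid3 i : (1 < i)%N ->
  M (predo i) * M i * M (predo i) = M i * M (predo i) * M i.
Proof.
move=> i1; have [i0 pi0] : (0 < i /\ 0 < predo i)%N by split=> /=; lia.
have fix_i : sgen (predo i) (i, false) = (i, false).
  by apply: sgen_fix => /=; lia.
have fix_ppi : sgen i (predo (predo i), false) = (predo (predo i), false).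
  by apply: sgen_fix => /=; lia.
apply: eq_mx_bvec => T TB; rewrite -!mulmxE !mulmxA.
have bf_gap := (bfE, content_gap_bswap, sgen_self false i0, sgen_predo false i0,
  sgen_self false pi0, sgen_predo false pi0, fix_i, fix_ppi).
set a := bf (predo i) T; set b := bf i T.
have ab : a + b = content_gap T (i, false) (predo (predo i), false).
  by rewrite addrC /a /b !bf_gap content_gapD.
have f_A : bf i (bswap (predo i) T) = a + b by rewrite ab !bf_gap.
have f_B : bf (predo i) (bswap i T) = a + b by rewrite ab !bf_gap.
have f_AB : bf (predo i) (bswap i (bswap (predo i) T)) = b by rewrite /b !bf_gap.
have f_BA : bf i (bswap (predo i) (bswap i T)) = a by rewrite /a !bf_gap.
have ab0 : a + b != 0.
  rewrite ab; apply: content_gap_neq0 TB _ _.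
    by rewrite xpair_eqE -(inj_eq (@ord_inj n)) /=; lia.
  by left; rewrite /signed_value /=; lia.
have BAB := bvec_seminormal f_BA; rewrite -bswap_braid3 // in BAB.
have nz : [/\ a != 0, b != 0 & a + b != 0] by rewrite !bf_neq0.
exact: (seminormal_braid3 nz (bvec_seminormal (erefl a)) (bvec_seminormalV (erefl a))
  (bvec_seminormal (erefl b)) (bvec_seminormalV (erefl b)) (bvec_seminormal f_A)
  (bvec_seminormal f_B) (bvec_seminormal f_AB) BAB).
Qed.

Lemma btab_mx_braid4 i : i = 1%N :> nat ->
  M (predo i) * M i * M (predo i) * M i = M i * M (predo i) * M i * M (predo i).
Proof.
move=> i1; have [i0 pi0] : (0 < i)%N /\ predo i = 0%N :> nat by split=> /=; lia.
have fix_i c : sgen (predo i) (i, c) = (i, c).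
  by apply: sgen_fix => /=; lia.
apply: eq_mx_bvec => T TB; rewrite -!mulmxE !mulmxA.
have s_i c : sgen i (i, c) = (predo i, c) by apply: sgen_self.
have s_pi c : sgen i (predo i, c) = (i, c) by apply: sgen_predo.
have s0 c : sgen (predo i) (predo i, c) = (predo i, ~~ c) by apply: sgen_self0.
have bf_gap := (bfE, content_gap_bswap, s_i, s_pi, s0, fix_i).
set a := bf (predo i) T; set b := bf i T.
have ab : a + b = content_gap T (i, false) (predo i, true).
  by rewrite addrC /a /b !bf_gap content_gapD.
have ba : b = content_gap T (predo i, true) (i, true).
  by rewrite /b !bf_gap -content_gap_negs.
have a2b : a + 2 * b = content_gap T (i, false) (i, true).
  by rewrite mulrDl mul1r addrA ab {1}ba content_gapD.
have f_A : bf i (bswap (predo i) T) = a + b by rewrite ab !bf_gap.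
have f_B : bf (predo i) (bswap i T) = a + 2 * b by rewrite a2b !bf_gap.
have f_AB : bf (predo i) (bswap i (bswap (predo i) T)) = a + 2 * b.
  by rewrite a2b !bf_gap.
have f_BA : bf i (bswap (predo i) (bswap i T)) = a + b.
  by rewrite ab !bf_gap -content_gap_negs.
have f_ABA : bf i (bswap (predo i) (bswap i (bswap (predo i) T))) = b.
  by rewrite ba !bf_gap.
have f_BAB : bf (predo i) (bswap i (bswap (predo i) (bswap i T))) = a.
  by rewrite /a !bf_gap.
have nz : [/\ a != 0, b != 0, a + b != 0 & a + 2 * b != 0].
  rewrite !bf_neq0 //; split=> //; rewrite ?ab ?a2b;
    apply: content_gap_neq0 TB _ _; rewrite ?xpair_eqE ?andbF //;
    by right; rewrite /signed_value /=; lia.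
have BABA := bvec_seminormal f_BAB; rewrite -bswap_braid4 // in BABA.
exact: (seminormal_braid4 nz (bvec_seminormal (erefl a)) (bvec_seminormalV (erefl a))
  (bvec_seminormal (erefl b)) (bvec_seminormalV (erefl b))
  (bvec_seminormal f_A) (bvec_seminormalV f_A)
  (bvec_seminormal f_B) (bvec_seminormalV f_B)
  (bvec_seminormal f_AB) (bvec_seminormal f_BA) (bvec_seminormal f_ABA) BABA).
Qed.

Lemma btab_mx_coxeter : coxeterB_relations M.
Proof.
split; [exact: btab_mxK | exact: btab_mx_comm | exact: btab_mx_braid3 |].
exact: btab_mx_braid4.
Qed.

Local Notation cell := ('I_(size mu) * 'I_(head 0%N mu))%type.
Local Notation SYT := (SYT mu nu n).
Implicit Types Q : {ffun 'I_n -> cell}.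

Lemma SYTP Q : reflect (standard nu Q (@nat_of_ord n)) (Q \in SYT).
Proof. by rewrite inE; apply: standardP. Qed.

Definition positive_btab Q : btab := [ffun k => (Q k, false)].

Lemma positive_btab_BT Q : (positive_btab Q \in BT) = (Q \in SYT).
Proof.
have id_bij : bijective (@id 'I_n) by exists id.
have cellE : bcell (positive_btab Q) =1 Q by move=> k; rewrite /bcell ffunE.
have entryE k : bentry (positive_btab Q) k = k.+1%:Z by rewrite /bentry ffunE.
by apply/BTP/SYTP; apply: (standard_transfer id_bij) => [k|k l _];
  rewrite ?entryE //= cellE.
Qed.

Lemma bswap_positive i Q :
  (0 < i)%N -> bswap i (positive_btab Q) = positive_btab (syt_swap i Q).
Proof.
move=> i0; apply/ffunP => k.
by rewrite !ffunE sgenV sgenE gtn_eqF //= !ffunE.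
Qed.

Lemma bf_positive i Q : (0 < i)%N -> bf i (positive_btab Q) = syt_h i Q.
Proof.
move=> i0; rewrite /bf gtn_eqF // /bc /bcontent_cell /bcell !ffunE /= /syt_h.
by rewrite opprD addrACA subrr addr0 -rmorphB /=; congr (_%:~R); ring.
Qed.

Definition positive_mx : 'M[algC]_(#|SYT|, #|BT|) :=
  \matrix_a bvec (positive_btab (enum_val a)).

Lemma sum_bvec_positive Q (c : algC) :
  \sum_(b < #|SYT|) ((enum_val b == Q)%:R * c) *: bvec (positive_btab (enum_val b))
  = c *: bvec (positive_btab Q).
Proof.
have [QS|QnS] := boolP (Q \in SYT).
  rewrite (bigD1 (enum_rank_in QS Q)) //= enum_rankK_in // eqxx mul1r big1 ?addr0 //.
  move=> b ne_b; case: eqP => [b_Q|_]; last by rewrite mul0r scale0r.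
  by case/eqP: ne_b; apply: enum_val_inj; rewrite enum_rankK_in.
rewrite bvec_out ?positive_btab_BT // scaler0 big1 // => b _.
by case: eqP QnS => [<-|]; rewrite ?enum_valP // mul0r scale0r.
Qed.

Lemma young_mul_positive_mx i :
  (0 < i)%N -> young_mx mu nu i *m positive_mx = positive_mx *m M i.
Proof.
move=> i0; apply/row_matrixP => a; rewrite !row_mul mulmx_sum_row rowK.
rewrite (bvec_seminormal (erefl _)) bf_positive // bswap_positive //.
rewrite -!sum_bvec_positive -big_split /=.
by apply: eq_bigr => b _; rewrite !mxE rowK -scalerDl.
Qed.

Definition neg_part x : nat := if x.2 then x.1.+1 else 0.

Definition negweight T : nat := \sum_(k < n) neg_part (sgn_entry T k).

Lemma negweight_act p T : p \in Bn n ->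
  negweight (btab_act p T) = (\sum_(k < n) neg_part (p (sgn_entry T k)))%N.
Proof.
move=> pB; rewrite [RHS](reindex (origin p)) /=; last exact/onW_bij/origin_bij.
by apply: eq_bigr => k _; rewrite -sgn_entry_act.
Qed.

(* No entry gains negative part: the only one that could is [- j], but [j] occurs
   with a positive sign. *)
Lemma negweight_bswap j T : (T j).2 -> ((T (predo j)).2 -> j = 0%N :> nat) ->
  (negweight (bswap j T) < negweight T)%N.
Proof.
move=> Tj Tpj; rewrite negweight_act ?sgen_Bn // /negweight.
rewrite (bigD1 j) //= [X in (_ < X)%N](bigD1 j) //= -addSn leq_add //.
  rewrite /sgn_entry /neg_part Tj; have [j0|j0] := posnP j; first by rewrite sgen_self0.
  by rewrite sgen_self //= prednK.
apply: leq_sum => k ne_kj; have [eq_k|ne_kpj] := eqVneq k (predo j); last first.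
  by rewrite sgen_fix.
have [j0|j0] := posnP j; first by case/eqP: ne_kj; apply: val_inj; rewrite eq_k /= j0.
rewrite eq_k /sgn_entry sgen_predo // /neg_part /=.
by case: ifP => // /Tpj; lia.
Qed.

(* Contents are at least 3/2 in absolute value as [m > 0], so [bf j T <= -3]. *)
Lemma offdiag_bf_neq0 j T : T \in BT -> (T j).2 ->
  ((T (predo j)).2 -> j = 0%N :> nat) -> offdiag (bf j T) != 0.
Proof.
move=> TB Tj Tpj; rewrite offdiag_eq0 bfE sqr_content_gap_eq1.
have := content2_bound (j, false) TB m0; have := content2_bound (sgen j (j, false)) TB m0.
have -> : (sgen j (j, false)).2 (+) (T (sgen j (j, false)).1).2 = false.
  have [j0|j0] := posnP j; first by rewrite sgen_self0 //= Tj.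
  by rewrite sgen_self //=; apply/negP => /Tpj; lia.
rewrite /= Tj; move: (content2 _ _) (content2 _ _) => c1 c2; nia.
Qed.

Lemma positive_mx_generates q (W : 'M[algC]_(q, #|BT|)) :
  (positive_mx <= W)%MS -> (forall i, stablemx W (M i)) -> row_full W.
Proof.
move=> posW stabW; suff genT T : (bvec T <= W)%MS.
  by rewrite -sub1mx; apply/row_subP => a; rewrite row1 -bvec_enum_val.
have [w] := ubnP (negweight T); elim: w => // w IHw in T * => lt_Tw.
have [TB|/bvec_out->] := boolP (T \in BT); last exact: sub0mx.
have [j1 Tj1|T_pos] := pickP (fun j => (T j).2); last first.
  pose Q := [ffun k => (T k).1]; have T_Q : T = positive_btab Q.
    by apply/ffunP => k; rewrite !ffunE -(T_pos k) -surjective_pairing.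
  have QS : Q \in SYT by rewrite -positive_btab_BT -T_Q.
  apply: submx_trans posW; rewrite T_Q -(enum_rankK_in QS QS).
  by rewrite -(rowK (fun a => bvec (positive_btab (enum_val a)))) row_sub.
case: (@arg_minnP _ j1 (fun j => (T j).2) val Tj1) => j Tj min_j.
have Tpj : (T (predo j)).2 -> j = 0%N :> nat by move/min_j => /=; lia.
apply: (seminormal_submx (bvec_seminormalV (erefl (bf j T))) _ (stabW j)).
  by rewrite offdiagN offdiag_bf_neq0.
exact/IHw/(leq_trans (negweight_bswap Tj Tpj)).
Qed.

Definition signed_rank (A : {set 'I_n}) : 'I_n -> 'I_n :=
  order_rank (fun k : 'I_n => signed_value (k, k \in A)).

Lemma signed_rank_bij (A : {set 'I_n}) : bijective (signed_rank A).
Proof. by apply/injF_bij/order_rank_inj => k l /signed_value_inj[]. Qed.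

Definition signed_btab Q (A : {set 'I_n}) : btab :=
  [ffun k => (Q (signed_rank A k), k \in A)].

Lemma signed_btab_inj Q1 Q2 A1 A2 :
  signed_btab Q1 A1 = signed_btab Q2 A2 -> (Q1, A1) = (Q2, A2).
Proof.
move/ffunP => eq_T; have eq_A : A1 = A2.
  by apply/setP => k; have := eq_T k; rewrite !ffunE => -[].
rewrite -eq_A in eq_T *; congr (_, _); apply/ffunP => k.
have [r _ rK] := signed_rank_bij A1.
by have := eq_T (r k); rewrite !ffunE rK => -[].
Qed.

Lemma signed_btab_BT Q A : Q \in SYT -> signed_btab Q A \in BT.
Proof.
move=> /SYTP std; apply/BTP; apply: standard_transfer (signed_rank_bij A) _ _ std.
  by move=> k; rewrite /bcell ffunE.
by move=> k l _; rewrite /bentry !ffunE /= ltEnat /= lt_order_rank.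
Qed.

Lemma leq_card_BT : (2 ^ n * #|SYT| <= #|BT|)%N.
Proof.
have <- : #|setX SYT [set: {set 'I_n}]| = (2 ^ n * #|SYT|)%N.
  by rewrite cardsX -powersetT card_powerset cardsT card_ord mulnC.
have f_inj : injective (fun QA => signed_btab QA.1 QA.2).
  by move=> [Q1 A1] [Q2 A2] /signed_btab_inj.
rewrite -(card_imset _ f_inj); apply/subset_leq_card/subsetP => _ /imsetP[[Q A] QS ->].
by move: QS; rewrite in_setX => /andP[/signed_btab_BT].
Qed.

End BTableaux.

(** * From the induced module to the tableau module *)

Section InducedFromTableaux.
Variables (mu nu : seq nat) (n m : nat).
Hypotheses (skew : is_skew_shape mu nu) (m0 : (0 < m)%N).
Variable sigma : gT n -> 'M[algC]_(#|SYT mu nu n|).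
Hypothesis sigmaP : mx_repr (Sn n) sigma.
Hypothesis sigma_sgen :
  forall i : 'I_n, (0 < i)%N -> sigma (sgen i) = young_mx mu nu i.
Local Notation M := (@btab_mx mu nu n m).

Definition ind_to_btab :
    'M[algC]_(\sum_(a < #|rtrans (Bn n) (Sn n)|) #|SYT mu nu n|, #|BT mu nu n|) :=
  frobmx M sigma (positive_mx mu nu n).

Lemma positive_mx_intertwines (i : 'I_n) : (0 < i)%N ->
  sigma (sgen i) *m positive_mx mu nu n = positive_mx mu nu n *m M i.
Proof. by move=> i0; rewrite sigma_sgen // (young_mul_positive_mx m skew). Qed.

Lemma ind_mul_ind_to_btab i :
  ind_rep (Bn n) (Sn n) sigma (sgen i) *m ind_to_btab = ind_to_btab *m M i.
Proof.
exact: ind_mul_frobmx (btab_mx_coxeter n skew m0) sigmaP positive_mx_intertwines i.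
Qed.

Lemma ind_to_btab_full : row_full ind_to_btab.
Proof.
apply: (positive_mx_generates skew m0 (submx_frobmx M _ sigmaP)).
exact: frobmx_stable (btab_mx_coxeter n skew m0) sigmaP positive_mx_intertwines.
Qed.

Lemma ind_to_btab_free : row_free ind_to_btab.
Proof.
rewrite /row_free eqn_leq rank_leq_row (eqP ind_to_btab_full) sum_nat_const card_ord.
apply: leq_trans (leq_card_BT mu nu n).
by rewrite leq_mul2r card_rtrans_le orbT.
Qed.

End InducedFromTableaux.

Unset Implicit Arguments.

Theorem theorem6p10 (n : nat) (mu nu : seq nat) (m : nat) :
  is_skew_shape mu nu -> (sumn mu - sumn nu)%N = n -> (0 < m)%N ->
  forall sigma : gT n -> 'M[algC]_(#|SYT mu nu n|),
    mx_repr (Sn n) sigma ->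
    (forall i : 'I_n, (0 < i)%N -> sigma (sgen i) = young_mx mu nu i) ->
  exists rho : gT n -> 'M[algC]_(#|BT mu nu n|),
    [/\ mx_repr (Bn n) rho,
        (forall i : 'I_n, rho (sgen i) = btab_mx mu nu m i) &
        rep_iso (Bn n) rho (ind_rep (Bn n) (Sn n) sigma)].
Proof.
move=> skew _ m0 sigma sigmaP sigma_sgen.
have full := ind_to_btab_full skew m0 sigmaP sigma_sgen.
have free := ind_to_btab_free skew m0 sigmaP sigma_sgen.
exists (transport (ind_rep (Bn n) (Sn n) sigma) (ind_to_btab m sigma)); split.
- exact: transport_repr (ind_rep_repr (Sn_sub n) sigmaP) free full.
- move=> i; apply: (transport_intertwined full).
  exact: (ind_mul_ind_to_btab skew m0 sigmaP sigma_sgen).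
exact: transport_iso free full.
Qed.
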